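(* Let $n\in\mathbb{N}$ and for $i=1,\dots,7$ let $d_i=7n(i-1)+1$ and $R_i=\{7,d_i,49n-d_i,49n+d_i,98n-d_i,98n+d_i,147n-d_i,147n+d_i\}$. Then the graphs $C_{343n}(R_i)$, $1\le i\le7$, are Type-2 isomorphic circulant graphs w.r.t. $m=7$, $T2_{343n,7}(C_{343n}(R_i))=\{C_{343n}(R_j):j=1,2,\dots,7\}$ for each $i$, and $(T2_{343n,7}(C_{343n}(R_i)),\circ)$ is a group (the Type-2 group).
   Context: Circulant graph $C_N(R)$: vertices $v_0,\dots,v_{N-1}$, $v_x$ adjacent to $v_{x\pm s}$, $s\in R$; jump sets written in $[1,N/2]$ after reflexive reduction modulo $N$ (reduce mod $N$, replace values $>N/2$ by $N$ minus the value). For $m\mid N$, $0\le t\le\tfrac Nm-1$, $\theta_{N,m,t}$ maps $v_x$, $x=qm+j$, $0\le j\le m-1$, to $u_{x+jmt}$ (subscripts mod $N$) and edges to pairs of images; $\theta_{N,m,t}(C_N(R))$ is the image graph, written $C_N(\theta_{N,m,t}(R))$. Type-2 isomorphism w.r.t. $m$: $C_N(R)$, $C_N(S)$ with $|R|=|S|\ge3$, $R\ne S$, are Type-2 isomorphic w.r.t. $m$ if some $r\in R$ has $m>1$, $m\mid\gcd(N,r)$, $m^3\mid N$, $\theta_{N,m,t}(C_N(R))=C_N(S)$ for some $1\le t\le\tfrac Nm-1$, and $S\ne xR$ (reflexive mod $N$) for all $x$ coprime to $N$. $T2_{N,m}(C_N(R))=\{C_N(R)\}\cup\{C_N(S):C_N(S)$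 Type-2 isomorphic to $C_N(R)$ w.r.t. $m\}$, with operation $\theta_{N,m,t}(C_N(R))\circ\theta_{N,m,t'}(C_N(R))=\theta_{N,m,t+t'}(C_N(R))$, $t+t'$ modulo $\tfrac Nm$. *)

(* Defs.v *)
From HB Require Import structures.
From mathcomp Require Import all_boot.
Set Implicit Arguments.
Unset Strict Implicit.
Unset Printing Implicit Defensive.

(* Labelled graphs on the vertex set v_0, ..., v_(N-1), given by their edge
   sets.  Equality of image graphs with circulant graphs is equality of labelled
   graphs, u_x and v_x being the same vertex x. *)
Definition graph (N : nat) : finType := {set {set 'I_N}}.

Definition shift (N : nat) (x : 'I_N) (k : nat) : 'I_N :=
  Ordinal (ltn_pmod (x + k) (leq_ltn_trans (leq0n x) (ltn_ord x))).

(* The pairs {x, x - s} need not be listed: they are {y, y + s} for y = x - s. *)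
Definition circulant (N : nat) (R : {set 'I_N}) : graph N :=
  [set [set x; shift x s] | x : 'I_N in setT, s : 'I_N in R].

Definition refl_mod (N k : nat) : nat :=
  let r := k %% N in if N < r.*2 then N - r else r.

Definition refl_set (N : nat) (A : seq nat) : {set 'I_N} :=
  [set k : 'I_N | (k : nat) \in [seq refl_mod N a | a <- A]].

Definition jump_set (N : nat) (R : {set 'I_N}) : Prop :=
  forall s : 'I_N, s \in R -> 0 < s /\ s.*2 <= N.

Definition mul_jumps (N x : nat) (R : {set 'I_N}) : {set 'I_N} :=
  refl_set N [seq x * (s : nat) | s : 'I_N <- enum R].

Definition theta (N m t : nat) (x : 'I_N) : 'I_N := shift x ((x %% m) * m * t).

Definition theta_graph (N m t : nat) (G : graph N) : graph N :=
  [set theta m t @: (e : {set 'I_N}) | e in G].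

Definition type2_iso (N m : nat) (R S : {set 'I_N}) : Prop :=
  [/\ jump_set R, jump_set S, #|R| = #|S|, 3 <= #|R| & R <> S] /\
  (exists r : 'I_N,
     [/\ r \in R, 1 < m, m %| gcdn N r, m ^ 3 %| N &
         exists t : nat, 1 <= t <= N %/ m - 1 /\
           theta_graph m t (circulant R) = circulant S]) /\
  (forall x : nat, coprime x N -> S <> mul_jumps x R).

Definition T2 (N m : nat) (R : {set 'I_N}) (G : graph N) : Prop :=
  G = circulant R \/
  exists S : {set 'I_N}, type2_iso m R S /\ G = circulant S.

Definition is_group (T : Type) (A : T -> Prop) (op : T -> T -> T) : Prop :=
  [/\ forall x y, A x -> A y -> A (op x y),
      forall x y z, A x -> A y -> A z -> op x (op y z) = op (op x y) z &
      exists e, [/\ A e, forall x, A x -> op e x = x /\ op x e = x &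
        forall x, A x -> exists y, [/\ A y, op x y = e & op y x = e]]].

(* Every member of T2 N m R is theta_graph m t (circulant R) for some t, not
   unique in general, so the condition determines op on T2 N m R, and the
   existence of op includes that the operation is well defined there. *)
Definition T2_is_group (N m : nat) (R : {set 'I_N}) : Prop :=
  let C := circulant R in
  exists op : graph N -> graph N -> graph N,
    (forall t t' : nat, t <= N %/ m - 1 -> t' <= N %/ m - 1 ->
       T2 m R (theta_graph m t C) -> T2 m R (theta_graph m t' C) ->
       op (theta_graph m t C) (theta_graph m t' C)
         = theta_graph m ((t + t') %% (N %/ m)) C) /\
    is_group (T2 m R) op.

Definition dval (n i : nat) : nat := 7 * n * (i - 1) + 1.

(* The listed values can exceed N / 2 = 343 n / 2 (for i >= 5), whence the
   reflexive reduction. *)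
Definition jumps (n i : nat) : {set 'I_(343 * n)} :=
  refl_set (343 * n)
    [:: 7; dval n i; 49 * n - dval n i; 49 * n + dval n i; 98 * n - dval n i;
        98 * n + dval n i; 147 * n - dval n i; 147 * n + dval n i].

(* Main.v *)
Require Import Defs.
From mathcomp Require Import all_boot zify.

(** Modulo N = 343 n the set R_i together with -R_i consists of 7, -7 and the
    two classes of d_i and -d_i modulo 49 n, so i matters only modulo 7.  The
    map theta_t adds 7 t to the length of an edge of length 1 mod 7, except
    that edges from residue 6 to residue 0 get 7 t - 49 t instead.  The image is
    therefore circulant exactly when n divides t, and t = n u maps R_i to
    R_(i+u).  A multiplier x taking R_i to R_j has to preserve {7, -7}, so x = 1
    or -1 mod 49 n, and it cannot move the class of d_i. *)

(** * Unordered pairs and congruences up to sign *)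

Lemma set2_eq (T : finType) (a b c d : T) :
  [set a; b] = [set c; d] -> a = c /\ b = d \/ a = d /\ b = c.
Proof.
move/setP=> E; have := (E a, E b, E c, E d); rewrite !inE !eqxx !orbT.
case=> [[[/esym/orP[]/eqP-> /esym/orP[]/eqP->]]]; rewrite ?orbb; auto.
  by rewrite eqxx => _ /eqP->; auto.
by rewrite eqxx => /eqP->; auto.
Qed.

Lemma eqmod_addN (M a b x y : nat) : M %| a + b ->
  x + a = y %[mod M] -> y + b = x %[mod M].
Proof.
move=> /eqP Mab E; rewrite -modnDml -E modnDml -addnA -modnDmr Mab.
by rewrite addn0.
Qed.

Lemma eqmod_dvd (d M a b : nat) : d %| M -> a = b %[mod M] -> a = b %[mod d].
Proof. by move=> dM E; rewrite -(modn_dvdm a dM) E modn_dvdm. Qed.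

(** Congruence up to sign, phrased with a sum because subtraction on [nat] truncates. Jumps matter
    only up to this relation modulo [N]. *)
Definition pm_mod (M a b : nat) : Prop := a = b %[mod M] \/ M %| a + b.

Lemma pm_sym (M a b : nat) : pm_mod M a b -> pm_mod M b a.
Proof. by case=> H; [left | right; rewrite addnC]. Qed.

Lemma pm_trans (M a b c : nat) : pm_mod M a b -> pm_mod M b c -> pm_mod M a c.
Proof.
case=> H [K|K].
- by left; rewrite H.
- by right; rewrite /dvdn -modnDml H modnDml.
- by right; rewrite /dvdn -modnDmr -K modnDmr.
left; apply/esym; rewrite -[c]add0n; apply: eqmod_addN K _.
by move/eqP: H; rewrite mod0n.
Qed.

Lemma pm_dvd (d M a b : nat) : d %| M -> pm_mod M a b -> pm_mod d a b.
Proof.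
by move=> dM [H|H]; [left; apply: eqmod_dvd dM H | right; apply: dvdn_trans H].
Qed.

Lemma pm_mul (M a b c : nat) : pm_mod M a b -> pm_mod M (a * c) (b * c).
Proof.
case=> H; [left; by rewrite -modnMml H modnMml | right].
by rewrite -mulnDl dvdn_mulr.
Qed.

Lemma pm_mulI (p M a b : nat) : 0 < p ->
  pm_mod (p * M) (p * a) (p * b) -> pm_mod M a b.
Proof.
move=> p_gt0 [|]; rewrite -?muln_modr -?mulnDr ?dvdn_pmul2l //; last by right.
by move/eqP; rewrite eqn_pmul2l // => /eqP; left.
Qed.

(** Changing the sign of a jump only swaps the two orientations of an edge, so a jump may be
    replaced by any representative up to sign. *)
Lemma pm_diff (M a b x y : nat) : pm_mod M a b ->
  x + a = y %[mod M] \/ y + a = x %[mod M] ->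
  x + b = y %[mod M] \/ y + b = x %[mod M].
Proof.
case=> [E|D]; last by case=> /(eqmod_addN _ _ _ _ _ D); auto.
by case=> <-; [left | right]; rewrite -modnDmr -E modnDmr.
Qed.

(** * Reflexive reduction *)

Lemma refl_mod_pm (N a : nat) : 0 < N -> pm_mod N (refl_mod N a) a.
Proof.
move=> N_gt0; rewrite /refl_mod; case: ifP => _; last by left; rewrite modn_mod.
right; rewrite /dvdn -modnDmr subnK ?modnn //; exact/ltnW/ltn_pmod.
Qed.

Lemma refl_mod_bound (N a : nat) : 0 < N ->
  refl_mod N a < N /\ (refl_mod N a).*2 <= N.
Proof.
by move=> N_gt0; have := ltn_pmod a N_gt0; rewrite /refl_mod; case: ifP; lia.
Qed.

Lemma refl_setP (N : nat) (A : seq nat) (k : 'I_N) :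
  reflect (exists2 a, a \in A & val k = refl_mod N a) (k \in refl_set N A).
Proof. by rewrite inE; apply: mapP. Qed.

Lemma mem_refl_set (N a : nat) (A : seq nat) : 0 < N -> a \in A ->
  exists2 k : 'I_N, k \in refl_set N A & val k = refl_mod N a.
Proof.
move=> N_gt0 Aa; have [lt_N _] := refl_mod_bound N a N_gt0.
by exists (Ordinal lt_N) => //; apply/refl_setP; exists a.
Qed.

(** * Edges of circulant graphs *)

Lemma circulantP (N : nat) (R : {set 'I_N}) (x y : 'I_N) :
  [set x; y] \in circulant R <->
  exists2 s : 'I_N, s \in R & x + s = y %[mod N] \/ y + s = x %[mod N].
Proof.
have valE (u v : 'I_N) k : shift u k = v <-> u + k = v %[mod N].
  rewrite (modn_small (ltn_ord v)); split=> [<- //|E]; exact/val_inj.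
split=> [/imset2P[z s _ Rs /set2_eq[[-> ->]|[-> ->]]]|[s Rs H]].
- by exists s => //; left; apply/valE.
- by exists s => //; right; apply/valE.
apply/imset2P; case: H => /valE <-; first by exists x s.
by exists y s => //; rewrite setUC.
Qed.

Lemma circulant_refl_setP (N : nat) (A : seq nat) (x y : 'I_N) :
  [set x; y] \in circulant (refl_set N A) <->
  exists2 a, a \in A & x + a = y %[mod N] \/ y + a = x %[mod N].
Proof.
have N_gt0 : 0 < N by apply: leq_ltn_trans (ltn_ord x).
rewrite circulantP; split=> [[s /refl_setP[a Aa ->] H]|[a Aa H]].
  by exists a => //; apply: pm_diff H; apply: refl_mod_pm.
have [s As Es] := mem_refl_set N a A N_gt0 Aa; exists s => //.
by apply: pm_diff H; apply: pm_sym; rewrite [nat_of_ord s]Es; apply: refl_mod_pm.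
Qed.

Lemma circulant_shift (N : nat) (R : {set 'I_N}) (x y : 'I_N) (k : nat) :
  [set x; y] \in circulant R -> [set shift x k; shift y k] \in circulant R.
Proof.
move/circulantP=> [s Rs H]; apply/circulantP; exists s => //=.
by case: H => H; [left | right]; rewrite modnDml modn_mod addnAC -modnDml H modnDml.
Qed.

(** The jumps are read off from the neighbours of vertex 0, since each lies between 1 and
    [N / 2]. *)
Lemma circulant_inj (N : nat) (R S : {set 'I_N}) :
  jump_set R -> jump_set S -> circulant R = circulant S -> R = S.
Proof.
suff sub (A B : {set 'I_N}) : jump_set A -> jump_set B ->
    circulant A = circulant B -> A \subset B.
  by move=> JR JS E; apply/eqP; rewrite eqEsubset !sub.
move=> JA JB E; apply/subsetP=> s As; have [s_gt0 sN] := JA _ As.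
have N_gt0 : 0 < N by apply: leq_ltn_trans (ltn_ord s).
have : [set Ordinal N_gt0; s] \in circulant A.
  by apply/circulantP; exists s => //; left.
rewrite E => /circulantP[r Br]; have [r_gt0 rN] := JB _ Br.
move=> H; suff -> : s = r by [].
have [ltr lts] := (ltn_ord r, ltn_ord s); apply/val_inj => /=.
case: H => /=; first by rewrite add0n !modn_small.
(* Here [N] divides [s + r]; as both are positive and at most [N / 2], both equal [N / 2]. *)
move/eqP; rewrite mod0n => /dvdnP[[|[|q]]]; lia.
Qed.

(** * The maps theta on vertices and on graphs *)

Lemma theta_modE (N m t d : nat) (x : 'I_N) : d %| N ->
  theta m t x = x + (x %% m) * m * t %[mod d].
Proof. by move=> dN; rewrite /= modn_dvdm. Qed.

(** Residues modulo [m] are preserved, so vertices with equal images have been displaced by the same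
    amount. *)
Lemma theta_inj (N m t : nat) : m %| N -> injective (@theta N m t).
Proof.
move=> mN x y E; apply/val_inj => /=.
have modE (z : 'I_N) : theta m t z = z %[mod m].
  by rewrite theta_modE // mulnAC addnC modnMDl.
have Em : x = y %[mod m] by rewrite -modE E modE.
have := theta_modE N m t N x (dvdnn _); rewrite E theta_modE // Em => /eqP.
by rewrite eqn_modDr !modn_small // => /eqP.
Qed.

Lemma theta_graphP (N m t : nat) (G : graph N) (x y : 'I_N) : m %| N ->
  ([set theta m t x; theta m t y] \in theta_graph m t G) = ([set x; y] \in G).
Proof.
move=> mN; rewrite -(imset_set1 (theta m t) y) -imsetU1 mem_imset //.
exact/imset_inj/theta_inj.
Qed.

Lemma circulant_pair (N : nat) (R : {set 'I_N}) (e : {set 'I_N}) :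
  e \in circulant R -> exists x y, e = [set x; y].
Proof. by case/imset2P=> x s _ _ ->; exists x, (shift x s). Qed.

Lemma theta_surj (N m t : nat) (y : 'I_N) : m %| N ->
  exists x : 'I_N, theta m t x = y.
Proof.
move=> /theta_inj/injF_bij - /(_ t)[g _ gK]; by exists (g y).
Qed.

(** Since [theta] is bijective on vertices, every pair is a pair of images, and comparing adjacency
    on images suffices. *)
Lemma theta_graph_circulant (N m t : nat) (R S : {set 'I_N}) : m %| N ->
  (forall x y : 'I_N, [set theta m t x; theta m t y] \in circulant S <->
                      [set x; y] \in circulant R) ->
  theta_graph m t (circulant R) = circulant S.
Proof.
move=> mN H; apply/setP=> e; apply/idP/idP.
  case/imsetP=> f Rf ->; have [x [y Ef]] := circulant_pair _ _ _ Rf.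
  by rewrite Ef imsetU1 imset_set1; apply/H; rewrite -Ef.
move=> Se; have [x [y Ee]] := circulant_pair _ _ _ Se.
have [[u Eu] [v Ev]] := (theta_surj N m t x mN, theta_surj N m t y mN).
by rewrite Ee -Eu -Ev theta_graphP //; apply/H; rewrite Eu Ev -Ee.
Qed.

(** * Lifts of a residue class, and the residues of the [dval n i] *)

Lemma eqmod_lift (p M a b : nat) : 0 < p -> 0 < M -> a = b %[mod M] ->
  exists2 k, k < p & a + M * k = b %[mod p * M].
Proof.
move=> p_gt0 M_gt0 E; have le_a : a <= p * M * a.
  by rewrite leq_pmull // muln_gt0 p_gt0.
(* The natural number [p * M * a - a] stands for [-a] modulo [p * M]. *)
have : M %| b + (p * M * a - a).
  rewrite /dvdn -modnDml -E modnDml subnKC // -mulnA mulnCA.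
  by rewrite modnMr.
case/dvdnP=> q Eq; exists (q %% p); first exact: ltn_pmod.
rewrite [p * M]mulnC muln_modr modnDmr [M * q]mulnC -Eq addnCA subnKC //.
by rewrite [p * M]mulnC [M * p * a]mulnC addnC modnMDl.
Qed.

Lemma dval_mod7 (n i : nat) : dval n i = 1 %[mod 7].
Proof. by rewrite /dval -mulnA mulnC modnMDl. Qed.

Lemma dval_eqmod (n i j : nat) : 0 < n -> 0 < i -> 0 < j ->
  dval n i = dval n j %[mod 49 * n] <-> i = j %[mod 7].
Proof.
move=> n_gt0 i_gt0 j_gt0.
have -> : 49 * n = 7 * n * 7 by lia.
have -> : (dval n i = dval n j %[mod 7 * n * 7])
   <-> (7 * n * (i - 1) = 7 * n * (j - 1) %[mod 7 * n * 7]).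
  by rewrite /dval; split=> /eqP E; apply/eqP; move: E; rewrite eqn_modDr.
rewrite -!muln_modr; split=> [/eqP|] E.
  move: E; rewrite eqn_pmul2l ?muln_gt0 // => /eqP E; lia.
by congr (_ * _); lia.
Qed.

(** The minus sign is impossible: [dval n i + dval n j] is 2 modulo 7. *)
Lemma dval_pm (n i j : nat) : 0 < n -> 0 < i -> 0 < j ->
  pm_mod (49 * n) (dval n i) (dval n j) -> i = j %[mod 7].
Proof.
move=> n_gt0 i_gt0 j_gt0 [/dval_eqmod -> //|H].
have : 7 %| dval n i + dval n j by apply: dvdn_trans H; rewrite -(mulnA 7 7) dvdn_mulr.
by rewrite /dvdn -modnDm !dval_mod7.
Qed.

(** * The jump sets: elements, size and adjacency *)

Section JumpSets.

Variable n : nat.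
Hypothesis n_gt0 : 0 < n.

Let N := 343 * n.
Let M := 49 * n.

Let N_gt0 : 0 < N. Proof. by rewrite muln_gt0. Qed.
Let M_gt0 : 0 < M. Proof. by rewrite muln_gt0. Qed.
Let N7M : N = 7 * M. Proof. by rewrite /N /M; lia. Qed.
Let M_dvd_N : M %| N. Proof. by rewrite N7M dvdn_mull. Qed.
Let dvd7M : 7 %| M. Proof. by rewrite /M -(mulnA 7 7) dvdn_mulr. Qed.
Let dvd7N : 7 %| N. Proof. by rewrite N7M dvdn_mulr. Qed.

Lemma dval_bound (i : nat) : i <= 7 -> 0 < dval n i <= 42 * n + 1.
Proof. by rewrite /dval; nia. Qed.

Let base (i : nat) : seq nat :=
  [:: 7; dval n i; 49 * n - dval n i; 49 * n + dval n i; 98 * n - dval n i;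
      98 * n + dval n i; 147 * n - dval n i; 147 * n + dval n i].

Lemma base_pm (i a : nat) : i <= 7 -> a \in base i -> a = 7 \/ pm_mod M a (dval n i).
Proof.
move=> /dval_bound/andP[_ d_le]; rewrite !inE => Aa.
have dvdM k : M %| M * k by rewrite dvdn_mulr.
have pm k : M * k + dval n i = dval n i %[mod M] by rewrite mulnC modnMDl.
case/or4P: Aa => [|||/or4P[|||/orP[]]] /eqP->; first (by left); right.
- by left.
- by right; rewrite subnK ?dvdnn //; lia.
- by left; rewrite -(pm 1) muln1.
- by right; rewrite subnK; [have -> : 98 * n = M * 2 by rewrite /M; lia | lia].
- by left; rewrite -(pm 2) /M; congr (_ %% _); lia.
- by right; rewrite subnK; [have -> : 147 * n = M * 3 by rewrite /M; lia | lia].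
- by left; rewrite -(pm 3) /M; congr (_ %% _); lia.
Qed.

Lemma mem_jumps (i : nat) (k : 'I_N) : i <= 7 -> k \in jumps n i ->
  k = 7 :> nat \/ pm_mod M k (dval n i).
Proof.
move=> i_le /refl_setP[a Aa Ek]; have := refl_mod_pm N a N_gt0.
rewrite -/N in Ek; rewrite -Ek => pm_k.
case: (base_pm i a i_le Aa) => [a7|pm_a]; last first.
  by right; apply: pm_trans pm_a; apply: pm_dvd pm_k.
left; rewrite [nat_of_ord k]Ek a7 /refl_mod modn_small; last by rewrite /N; lia.
by rewrite ifF // /N; lia.
Qed.

Lemma jump_set_jumps (i : nat) : i <= 7 -> jump_set (jumps n i).
Proof.
move=> i_le s Rs; have [a _ Es] := refl_setP _ _ _ Rs.
have [_] := refl_mod_bound N a N_gt0; rewrite -[refl_mod _ _]Es; split=> //.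
(* Zero is neither 7 nor congruent to plus or minus [dval n i], which is 1 modulo 7. *)
rewrite lt0n; apply/eqP=> s0; have := mem_jumps i s i_le Rs; rewrite s0.
case=> // /(pm_dvd 7 _ _ _ dvd7M); rewrite /pm_mod /dvdn add0n dval_mod7.
by case=> // /eqP.
Qed.

Lemma base_in_jumps (i a : nat) : a \in base i -> a.*2 <= N ->
  exists2 k : 'I_N, k \in jumps n i & k = a :> nat.
Proof.
move=> Aa a_le; have [k Rk Ek] := mem_refl_set N a (base i) N_gt0 Aa.
by exists k; rewrite // [nat_of_ord k]Ek /refl_mod modn_small ?ifF; lia.
Qed.

Lemma card_jumps (i : nat) : i <= 7 -> #|jumps n i| = 8.
Proof.
move=> i_le; pose s := [seq refl_mod N a | a <- base i].
have s_uniq : uniq s.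
  have /andP[d_gt0 d_le] := dval_bound i i_le.
  (* This form gives residues modulo 7: 0 for the jump 7, and 1 or 6 according to the sign of
     [dval n i]. Values of equal sign differ by a nonzero multiple of [49 * n]. *)
  have [e Ed] : exists e, dval n i = 7 * e + 1.
    by exists (n * (i - 1)); rewrite /dval mulnA.
  have small a : a.*2 <= N -> refl_mod N a = a.
    by move=> a_le; rewrite /refl_mod modn_small ?ifF; lia.
  (* Only the last listed value can exceed [N / 2]; its reflection is
     [343 * n - (147 * n + dval n i)]. *)
  have [L EL HL] : exists2 L, refl_mod N (147 * n + dval n i) = L &
      L = 147 * n + dval n i \/ L = 196 * n - dval n i.
    exists (refl_mod N (147 * n + dval n i)) => //.
    rewrite /refl_mod modn_small; last by rewrite /N; lia.
    by case: ifP => _; [right; rewrite /N; lia | left].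
  have -> : s = rcons (take 7 (base i)) L.
    rewrite /s /base /= EL.
    by congr [:: _, _, _, _, _, _, _ & _]; apply: small; rewrite /N; lia.
  rewrite /base /=; move: (dval n i) Ed d_gt0 d_le HL => d -> _ d_le HL.
  rewrite !inE !negb_or -!andbA.
  by case: HL => ->; do !(apply/andP; split) => //; apply/eqP; lia.
have s_lt : all (ltn^~ N) s.
  by apply/allP=> _ /mapP[a _ ->]; case: (refl_mod_bound N a N_gt0).
have -> : jumps n i = [set k in pmap insub s].
  by apply/setP=> k; rewrite /jumps !in_set mem_pmap_sub.
rewrite cardsE (card_uniqP _) ?pmap_sub_uniq // size_pmap_sub.
by move: s_lt; rewrite all_count => /eqP.
Qed.

(** Up to sign, the seven lifts modulo [N] of the class of [dval n i] modulo [M] are exactly the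
    listed values other than 7. *)
Lemma circulant_jumpsP (i : nat) (x y : 'I_N) : i <= 7 ->
  [set x; y] \in circulant (jumps n i) <->
  (x + 7 = y %[mod N] \/ y + 7 = x %[mod N]) \/
  (x + dval n i = y %[mod M] \/ y + dval n i = x %[mod M]).
Proof.
move=> i_le; rewrite circulant_refl_setP -/(base i) -/N.
have /andP[_ d_le] := dval_bound i i_le.
split=> [[a /(base_pm i a i_le)[-> | pm_a] H]|[H|H]].
- by left; exact: H.
- by right; apply: pm_diff pm_a _; case: H => /(eqmod_dvd _ _ _ _ M_dvd_N); auto.
- by exists 7; rewrite ?mem_head.
suff sub (u v : 'I_N) : u + dval n i = v %[mod M] ->
    exists2 a, a \in base i & u + a = v %[mod N] \/ v + a = u %[mod N].
  case: H => /sub // [a Aa H]; exists a => //; tauto.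
case/(eqmod_lift 7 _ _ _ isT M_gt0) => k k_lt; rewrite -N7M -addnA => E.
have opp c : dval n i + M * k + c = N -> v + c = u %[mod N].
  by move=> Ec; apply: eqmod_addN E; rewrite Ec.
have pick j : j < size (base i) -> let c := nth 0 (base i) j in
    dval n i + M * k = c \/ dval n i + M * k + c = N ->
    exists2 a, a \in base i & u + a = v %[mod N] \/ v + a = u %[mod N].
  move=> j_lt c Ec; exists c; first exact: mem_nth.
  by case: Ec => [<-|Ec]; [left | right; apply: opp].
(* The lifts [dval n i + M * k] with [k] from 0 to 3 are listed themselves; for [k] from 4 to 6
   their negatives [M * (7 - k) - dval n i] are. *)
do 7?[case: k k_lt E opp pick => [|k] k_lt E opp pick //].
- apply: (pick 1 isT); left; rewrite /= /M /N; clear -n_gt0 d_le; lia.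
- apply: (pick 3 isT); left; rewrite /= /M /N; clear -n_gt0 d_le; lia.
- apply: (pick 5 isT); left; rewrite /= /M /N; clear -n_gt0 d_le; lia.
- apply: (pick 7 isT); left; rewrite /= /M /N; clear -n_gt0 d_le; lia.
- apply: (pick 6 isT); right; rewrite /= /M /N; clear -n_gt0 d_le; lia.
- apply: (pick 4 isT); right; rewrite /= /M /N; clear -n_gt0 d_le; lia.
- apply: (pick 2 isT); right; rewrite /= /M /N; clear -n_gt0 d_le; lia.
Qed.

(** * Images of the graphs under theta *)

Lemma theta_mod_m (t : nat) (x : 'I_N) : theta 7 t x = x %[mod 7].
Proof. by rewrite theta_modE // mulnAC addnC modnMDl. Qed.

(** Addition in the integers modulo 7, with representatives 1 to 7. *)
Let step (i u : nat) : nat := (i - 1 + u) %% 7 + 1.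

Lemma step_bound (i u : nat) : 1 <= step i u <= 7.
Proof. by rewrite /step; lia. Qed.

Lemma dval_step (i u : nat) : dval n (step i u) = dval n i + 7 * (n * u) %[mod M].
Proof.
rewrite /dval /step addnK /M addnAC; apply/eqP; rewrite eqn_modDr.
have -> : 49 * n = 7 * n * 7 by lia.
by rewrite mulnA -mulnDr -!muln_modr modn_mod.
Qed.

Lemma theta_jumps (i u : nat) : 1 <= i <= 7 ->
  theta_graph 7 (n * u) (circulant (jumps n i)) = circulant (jumps n (step i u)).
Proof.
move=> /andP[i_gt0 i_le]; have /andP[_ step_le] := step_bound i u.
apply: theta_graph_circulant => // x y; rewrite !circulant_jumpsP //.
set t := n * u.
(* The ends of an edge of length 7 share their residue modulo 7 and move by the same amount. *)
have long (v w : 'I_N) :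
    theta 7 t v + 7 = theta 7 t w %[mod N] <-> v + 7 = w %[mod N].
  suff H : v = w %[mod 7] -> theta 7 t v + 7 = theta 7 t w %[mod N] <->
      v + 7 = w %[mod N].
    have mod7 a b : a + 7 = b %[mod N] -> a = b %[mod 7].
      by move=> /(eqmod_dvd _ _ _ _ dvd7N) <-; rewrite modnDr.
    by split=> E; apply/H => //; have := mod7 _ _ E; rewrite ?theta_mod_m.
  move=> Evw; rewrite -modnDml !theta_modE // modnDml Evw addnAC.
  by split=> /eqP E; apply/eqP; move: E; rewrite eqn_modDr.
have short (v w : 'I_N) :
    theta 7 t v + dval n (step i u) = theta 7 t w %[mod M] <->
    v + dval n i = w %[mod M].
  (* Either side of the equivalence forces this residue condition, because [dval] is 1 modulo 7 and
     [theta] keeps residues. *)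
  suff H : v + 1 = w %[mod 7] ->
      theta 7 t v + dval n (step i u) = theta 7 t w %[mod M] <->
      v + dval n i = w %[mod M].
    have mod7 a b j : a + dval n j = b %[mod M] -> a + 1 = b %[mod 7].
      by move=> /(eqmod_dvd _ _ _ _ dvd7M) <-; rewrite -[RHS]modnDmr dval_mod7 modnDmr.
    split=> E; apply/H => //; have := mod7 _ _ _ E => //.
    by rewrite theta_mod_m -modnDml theta_mod_m modnDml.
  move=> Evw.
  have -> : theta 7 t w = w + (v + 1) %% 7 * 7 * t %[mod M].
    by rewrite theta_modE // -Evw.
  have -> : theta 7 t v + dval n (step i u) =
      v + dval n i + (v %% 7 + 1) * 7 * t %[mod M].
    by rewrite -modnDm theta_modE // dval_step modnDm; congr (_ %% _); lia.
  (* The two multipliers differ only at the wrap from residue 6 to 0, where the discrepancy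
     [7 * 7 * t] is [u * M], zero modulo [M]. *)
  have -> : v + dval n i + (v %% 7 + 1) * 7 * t =
      v + dval n i + (v + 1) %% 7 * 7 * t %[mod M].
    have [-> //|Ev] : (v + 1) %% 7 = v %% 7 + 1 \/ (v + 1) %% 7 = 0 by lia.
    have -> : (v %% 7 + 1) * 7 * t = u * M.
      have -> : v %% 7 = 6 by lia.
      rewrite /t /M; lia.
    by rewrite Ev !mul0n addn0 addnC modnMDl.
  by split=> /eqP E; apply/eqP; move: E; rewrite eqn_modDr.
have := (long x y, long y x, short x y, short y x); tauto.
Qed.

(* Compare the images of the edges {0, d_i} and {6, 6 + d_i}: the wrap-around
   of residues mod 7 makes their lengths differ by 49 t. *)
Lemma theta_circulant_dvd (i t : nat) (S : {set 'I_N}) : i <= 7 ->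
  theta_graph 7 t (circulant (jumps n i)) = circulant S -> n %| t.
Proof.
move=> i_le E.
have lt6N : 6 < N by rewrite /N; lia.
pose x0 := Ordinal N_gt0; pose x6 := Ordinal lt6N.
pose y := shift x0 (dval n i).
have edge : [set x0; y] \in circulant (jumps n i).
  by apply/circulant_jumpsP => //; right; left; rewrite /= modn_dvdm.
have := edge; rewrite -(theta_graphP N 7 t) // E.
have Ey : y = 1 %[mod 7] by rewrite /= modn_dvdm // dval_mod7.
have T0 : theta 7 t x0 = 0 :> nat by exact: (mod0n N).
(* This is the image of vertex 6; as vertex 0 is fixed, rotating by [k] carries the image of 0 to
   the image of 6. *)
pose k := 6 + 6 * 7 * t.
have Ek : shift (theta 7 t x0) k = theta 7 t x6.
  apply/val_inj; rewrite -[LHS]/((theta 7 t x0 + k) %% N) T0.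
  by rewrite add0n -[RHS]/((6 + 6 %% 7 * 7 * t) %% N).
move/(circulant_shift _ _ _ _ k); rewrite Ek -E.
have [z Ez] := theta_surj N 7 t (shift (theta 7 t y) k) dvd7N.
rewrite -Ez theta_graphP //.
(* The vertex [y] has residue 1, so its image is [dval n i + 7 * t]; adding [k] gives the value
   stated. *)
have Ezd d : d %| N -> theta 7 t z = dval n i + 6 + 49 * t %[mod d].
  move=> dN; have Ey_d : y = dval n i %[mod d] by rewrite /= add0n modn_dvdm.
  rewrite Ez -[nat_of_ord (shift _ k)]/((theta 7 t y + k) %% N) modn_dvdm //.
  rewrite -modnDml theta_modE // modnDml Ey -addnA -modnDml Ey_d modnDml.
  rewrite -(addnA (dval n i)); congr ((_ + _) %% _); rewrite /k modn_small //; clear; lia.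
have z7 : z %% 7 = 0.
  rewrite -(theta_mod_m t) (Ezd 7 dvd7N) -addnA -modnDml dval_mod7 modnDml.
  lia.
have zM : z = dval n i + 6 + 49 * t %[mod M].
  by rewrite -(Ezd M M_dvd_N) theta_modE // z7 !mul0n addn0.
(* Vertex 6 and [z] have residues 6 and 0 modulo 7, which leaves only [6 + dval n i = z] modulo [M],
   that is, [49 * n] divides [49 * t]. *)
case/circulant_jumpsP => // -[[]|[]].
- by move/(eqmod_dvd _ _ _ _ dvd7N); rewrite z7.
- by move/(eqmod_dvd _ _ _ _ dvd7N); rewrite -modnDml z7.
- have -> : x6 + dval n i = dval n i + 6 + 0 by rewrite addn0 addnC.
  rewrite zM => /eqP; rewrite eqn_modDl mod0n eq_sym -/(M %| 49 * t).
  by rewrite dvdn_pmul2l.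
move/(eqmod_dvd _ _ _ _ dvd7M).
by rewrite -modnDm z7 dval_mod7.
Qed.

(** * Distinctness of the jump sets, also under multipliers *)

Lemma jumps_not_mul (i j x : nat) : 1 <= i <= 7 -> 1 <= j <= 7 -> i <> j ->
  jumps n j <> mul_jumps x (jumps n i).
Proof.
move=> /andP[i_gt0 i_le] /andP[j_gt0 j_le] neq_ij E.
have /andP[d_gt0 d_le] := dval_bound i i_le.
suff : pm_mod M (dval n i) (dval n j) by move/dval_pm => /(_ n_gt0 i_gt0 j_gt0); lia.
have img a : a \in base i -> a.*2 <= N -> exists2 k : 'I_N,
    pm_mod N k (x * a) & k = 7 :> nat \/ pm_mod M k (dval n j).
  move=> Aa a_le; have [b Rb Eb] := base_in_jumps i a Aa a_le.
  have : x * b \in [seq x * (s : nat) | s : 'I_N <- enum (jumps n i)].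
    by apply/mapP; exists b; rewrite ?mem_enum.
  case/(mem_refl_set N _ _ N_gt0) => k; rewrite -[refl_set _ _]E Eb => Rk Ek.
  exists k; last exact: mem_jumps Rk.
  by rewrite [nat_of_ord k]Ek; apply: refl_mod_pm.
have [||k pm_k k7] := img 7; rewrite ?mem_head //; first by rewrite /N; lia.
(* The image of the jump 7 is a multiple of 7, hence is the jump 7; cancelling 7 lowers the modulus
   from [N] to [M]. *)
have pm_x : pm_mod M x 1.
  apply: pm_sym; apply: (pm_mulI 7) => //; rewrite -N7M muln1 [7 * x]mulnC.
  case: k7 pm_k => [-> //|pm_kj] pm_k.
  have := pm_trans _ _ _ _ (pm_sym _ _ _ (pm_dvd _ _ _ _ dvd7N pm_k))
    (pm_dvd _ _ _ _ dvd7M pm_kj).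
  by rewrite /pm_mod /dvdn modnMDl modnMl dval_mod7; case.
have [||l pm_l l7] := img (dval n i); first by rewrite !inE eqxx orbT.
  by rewrite /N; lia.
have pm_li : pm_mod M l (dval n i).
  apply: pm_trans (pm_dvd _ _ _ _ M_dvd_N pm_l) _.
  by rewrite -[X in pm_mod _ _ X]mul1n; apply: pm_mul.
(* The image of [dval n i] is not 7, being 1 or 6 modulo 7. *)
case: l7 => [l7|]; last exact/pm_trans/pm_sym.
move: pm_li; rewrite l7 => /(pm_dvd _ _ _ _ dvd7M).
by rewrite /pm_mod /dvdn -modnDmr dval_mod7; case.
Qed.

Lemma jumps_inj (i j : nat) : 1 <= i <= 7 -> 1 <= j <= 7 ->
  jumps n i = jumps n j -> i = j.
Proof.
move=> /andP[i_gt0 i_le] /andP[j_gt0 j_le] E.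
have /andP[_ d_le] := dval_bound i i_le.
have [||k] := base_in_jumps i (dval n i); first by rewrite !inE eqxx orbT.
  by rewrite /N; lia.
rewrite E => /(mem_jumps j k j_le)[-> E7|pm_k Ek].
  by have := dval_mod7 n i; rewrite -E7.
by move: pm_k; rewrite Ek => /dval_pm => /(_ n_gt0 i_gt0 j_gt0); lia.
Qed.

(** * The Type-2 set and its group *)

Let step_onto (i j : nat) : 1 <= i <= 7 -> 1 <= j <= 7 ->
  step i (7 + j - i) = j.
Proof. by rewrite /step; lia. Qed.

Let divN7 : N %/ 7 = M. Proof. by rewrite N7M mulKn. Qed.

Lemma jumps_type2 (i j : nat) : 1 <= i <= 7 -> 1 <= j <= 7 -> i <> j ->
  type2_iso 7 (jumps n i) (jumps n j).
Proof.
move=> i17 j17 neq_ij; have [/andP[i_gt0 i_le] /andP[j_gt0 j_le]] := (i17, j17).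
split; [|split]; last by move=> x _; apply: jumps_not_mul.
  split; rewrite ?card_jumps //; try exact: jump_set_jumps.
  by move/jumps_inj; auto.
have [||r Rr Er] := base_in_jumps i 7; rewrite ?mem_head //.
  by rewrite /N; lia.
exists r; split=> //; first by rewrite Er dvdn_gcd dvd7N.
  by rewrite dvdn_mulr.
(* The 7 keeps [j - i] from truncating; since [i] and [j] differ, this [t] lies between [n] and
   [6 * n]. *)
exists (n * ((7 + j - i) %% 7)); split.
  have : 0 < (7 + j - i) %% 7 < 7 by lia.
  rewrite -/N divN7 /M; move: (_ %% 7) => u; clear -n_gt0; nia.
by rewrite theta_jumps //; congr (circulant (jumps n _)); rewrite /step; lia.
Qed.

(** A circulant image forces [t] to be a multiple of [n], so the Type-2 set is one orbit of the
    cyclic shift of indices. *)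
Lemma T2_jumpsP (i : nat) (G : graph N) : 1 <= i <= 7 ->
  T2 7 (jumps n i) G <-> exists u, G = circulant (jumps n (step i u)).
Proof.
move=> i17; have /andP[i_gt0 i_le] := i17; split.
  case=> [->|[S [[_ [[r [_ _ _ _ [t [_ Et]]]] _]] ->]]].
    by exists 0; rewrite /step; congr (circulant (jumps n _)); lia.
  have /dvdnP[u Eu] := theta_circulant_dvd i t S i_le Et.
  by exists u; rewrite -Et Eu (mulnC u n) theta_jumps.
case=> u ->; have [->|neq] := eqVneq (step i u) i; first by left.
right; exists (jumps n (step i u)); split=> //.
by apply: jumps_type2 => //; [apply: step_bound | apply/eqP; rewrite eq_sym].
Qed.

(** The group structure of the integers modulo 7 is transported along [C], which is injective modulo
    7. *)
Lemma T2_jumps_group (i : nat) : 1 <= i <= 7 -> T2_is_group 7 (jumps n i).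
Proof.
move=> i17; have /andP[i_gt0 i_le] := i17.
pose C u := circulant (jumps n (step i u)).
have C_mod u v : u = v %[mod 7] -> C u = C v.
  by move=> E; congr (circulant (jumps n _)); rewrite /step; lia.
have C_inj u v : C u = C v -> u = v %[mod 7].
  move/circulant_inj; rewrite /step => E.
  have [/andP[_ lu] /andP[_ lv]] := (step_bound i u, step_bound i v).
  have := jumps_inj _ _ (step_bound i u) (step_bound i v)
    (E (jump_set_jumps _ lu) (jump_set_jumps _ lv)).
  by rewrite /step; lia.
(* The default [ord0] is taken only off the orbit, where the value of [op] is irrelevant. *)
pose idx G := odflt ord0 [pick u : 'I_7 | G == C u].
have idxC u : idx (C u) = u %[mod 7].
  rewrite /idx; case: pickP => [v /eqP/C_inj -> //|/(_ (inord (u %% 7)))/eqP[]].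
  by apply: C_mod; rewrite inordK ?modn_mod // ltn_pmod.
pose op G H := C (idx G + idx H).
have opC u v : op (C u) (C v) = C (u + v).
  by apply: C_mod; rewrite -modnDm !idxC modnDm.
clearbody op.
have thetaC u : theta_graph 7 (u * n) (circulant (jumps n i)) = C u.
  by rewrite (mulnC u n); exact: theta_jumps.
have T2_dvd t : T2 7 (jumps n i) (theta_graph 7 t (circulant (jumps n i))) -> n %| t.
  by move/(T2_jumpsP _ _ i17) => [u /theta_circulant_dvd]; apply.
exists op; split.
  move=> t t' _ _ /T2_dvd/dvdnP[u ->] /T2_dvd/dvdnP[u' ->].
  (* Exponents add modulo [49 * n], so the indices add modulo 49, which is compatible with modulo
     7. *)
  have -> : (u * n + u' * n) %% (N %/ 7) = (u + u') %% 49 * n.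
    by rewrite divN7 /M -mulnDl -muln_modl.
  by rewrite !thetaC opC; apply: C_mod; rewrite modn_dvdm.
split.
- move=> _ _ /(T2_jumpsP _ _ i17)[u ->] /(T2_jumpsP _ _ i17)[v ->].
  by apply/(T2_jumpsP _ _ i17); exists (u + v); apply: opC.
- move=> x y z /(T2_jumpsP _ _ i17)[u ->] /(T2_jumpsP _ _ i17)[v ->].
  by move=> /(T2_jumpsP _ _ i17)[w ->]; rewrite !opC addnA.
exists (C 0); split; first by apply/(T2_jumpsP _ _ i17); exists 0.
  by move=> _ /(T2_jumpsP _ _ i17)[u ->]; rewrite !opC addn0.
(* [6 * u] is [-u] modulo 7. *)
move=> _ /(T2_jumpsP _ _ i17)[u ->]; exists (C (6 * u)).
split; first by apply/(T2_jumpsP _ _ i17); exists (6 * u).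
  by rewrite opC; apply: C_mod; lia.
by rewrite opC; apply: C_mod; lia.
Qed.

Lemma T2_jumps (i : nat) (G : graph N) : 1 <= i <= 7 ->
  T2 7 (jumps n i) G <-> exists j, 1 <= j <= 7 /\ G = circulant (jumps n j).
Proof.
move=> i17; rewrite T2_jumpsP //; split=> [[u ->]|[j [j17 ->]]].
  by exists (step i u); rewrite step_bound.
by exists (7 + j - i); rewrite step_onto.
Qed.

End JumpSets.

Theorem theorem5p11 (n : nat) (n_gt0 : 0 < n) :
  (forall i j : nat, 1 <= i <= 7 -> 1 <= j <= 7 -> i <> j ->
     type2_iso 7 (jumps n i) (jumps n j)) /\
  (forall i : nat, 1 <= i <= 7 ->
     (forall G : graph (343 * n),
        T2 7 (jumps n i) G <->
        exists j : nat, 1 <= j <= 7 /\ G = circulant (jumps n j)) /\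
     T2_is_group 7 (jumps n i)).
Proof.
split=> [i j | i i17]; first exact: jumps_type2.
by split=> [G|]; [apply: T2_jumps | apply: T2_jumps_group].
Qed.
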